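(* Let $\Omega\subset\mathbb{C}$ be a compact set with more than one point. Let $\Omega^\infty$ be a countable product of copies of $\Omega$ (indexed by $n=0,1,2,\dots$) in the weak topology. Then $$\Bigl\{\{a_n\}_{n=0}^\infty\in\Omega^\infty \;\Bigm|\; \sum_{n=0}^\infty a_n z^n \text{ has a natural boundary on } \partial\mathbb{D}\Bigr\}$$ is a dense $G_\delta$ in $\Omega^\infty$.
   Context: $\mathbb{D}=\{z\in\mathbb{C}: |z|<1\}$ and $\partial\mathbb{D}$ is the unit circle. The weak topology on $\Omega^\infty$ is the product topology, i.e. the topology of pointwise convergence of the $a_n$. Natural boundary: a function $f$ analytic on $\mathbb{D}$ has a natural boundary on $\partial\mathbb{D}$ if for no $z_0=e^{i\theta}\in\partial\mathbb{D}$ does $f$ have an analytic continuation to $\{z: |z-z_0|<\delta\}$ for some $\delta>0$. *)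

(* Defs.v *)
From mathcomp Require Import all_boot all_order all_algebra.
From mathcomp Require Import all_classical all_reals all_analysis.
From mathcomp Require Import complex borel_hierarchy.

Set Implicit Arguments.
Unset Strict Implicit.
Unset Printing Implicit Defensive.

Import Order.TTheory GRing.Theory Num.Theory numFieldNormedType.Exports.

Local Open Scope classical_set_scope.
Local Open Scope ring_scope.
Local Open Scope complex_scope.

(* [complex] has no topology of its own in the library; seen as a
   [numClosedFieldType], R[i] receives the norm topology that
   [numFieldNormedType.Exports] gives to every [numFieldType].
   Norms and radii are elements of [Cplx R]; in its partial order, [0 < r]
   means that r is a positive real number. *)
Definition Cplx (R : realType) : numClosedFieldType := R[i].

Section NaturalBoundary.
Context {R : realType}.
Local Notation C := (Cplx R).

Definition unit_disk : set C := ball (0 : C) 1.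

(* The sequence of partial sums, not their limit. *)
Definition power_series (c : C^nat) (z0 z : C) : C^nat :=
  series (fun n => c n * (z - z0) ^+ n).

(* Only meaningful where the series converges: [limn] is a total function. *)
Definition power_series_sum (c : C^nat) (z : C) : C :=
  limn (power_series c 0 z).

Definition analytic_at (f : C -> C) (z0 : C) : Prop :=
  exists r : C, 0 < r /\ exists c : C^nat,
    forall z, ball z0 r z -> power_series c z0 z @ \oo --> f z.

Definition analytic_on (U : set C) (f : C -> C) : Prop :=
  forall z, U z -> analytic_at f z.

(* g is an analytic continuation to V of the function f on U; the values of g
   off V and of f off U play no role. *)
Definition analytic_continuation (U V : set C) (f g : C -> C) : Prop :=
  analytic_on V g /\ forall z, (U `&` V) z -> g z = f z.

Definition has_natural_boundary (f : C -> C) : Prop :=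
  analytic_on unit_disk f /\
  forall z0 : C, `|z0| = 1 ->
    ~ exists delta : C, 0 < delta /\
        exists g : C -> C, analytic_continuation unit_disk (ball z0 delta) f g.

End NaturalBoundary.

(* Main.v *)
Require Import Defs.
From mathcomp Require Import all_boot all_order all_algebra.
From mathcomp Require Import all_classical all_reals all_analysis.
From mathcomp Require Import complex borel_hierarchy ring lra.
Import Order.TTheory GRing.Theory Num.Theory numFieldNormedType.Exports.
Local Open Scope classical_set_scope.
Local Open Scope ring_scope.

(** Write f_a for the sum of the power series with coefficients a.  Since
    Omega is bounded, f_a is analytic on the unit disk for every a, so the
    only question is whether f_a continues across some point of the circle.

    The set is a G_delta.  Continuation across the circle is the same as
    overconvergence: at some point w of the disk, the Taylor series of f_a has
    radius of convergence larger than 1 - |w|.  The point w can be moved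
    slightly, so it may be taken with rational real and imaginary parts, and
    the radius condition is a union over m of the conditions
      |b_k(a, w)| (1 - |w| + 1/(m+1))^k <= m  for every k,
    where b_k(a, w) is the k-th Taylor coefficient of f_a at w.  As b_k(a, w)
    is a series in the coordinates of a converging uniformly in a, it is
    continuous in a, and each such condition is closed.  The complement of the
    set is therefore a countable union of closed sets
    ([natural_boundary_Gdelta]).  The equivalence is [overconverges_continues]
    and [continues_overconverges]; both rest on recentring a power series
    inside its disk of convergence ([power_series_recenter]) and on the
    uniqueness of its coefficients ([power_series_unique]).  At a point z near
    w/|w|, the continuation is compared with f_a by recentring both, once, at
    the point of modulus |w| that has the argument of z.

    The set is dense.  Given b in Omega^oo, alpha <> beta in Omega and N, let
    a agree with b below N, and beyond N let a_n be beta when n is a power of 2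
    and alpha otherwise.  Up to a polynomial, f_a is the sum of
    alpha / (1 - z), which is bounded outside any neighbourhood of 1, and of beta - alpha times the
    lacunary series of the z^(2^k).  At a root of unity zeta of order a power
    of 2, all but finitely many terms of the lacunary series are positive on the
    radius through zeta, so f_a is unbounded there as soon as zeta <> 1
    ([lacunary_radial_growth]).  These zeta are dense in the circle
    ([dyadic_root_near]), hence f_a has a natural boundary, and a tends to b
    as N grows. *)

(** * The real-valued modulus *)

Section Modulus.
Set Implicit Arguments.
Unset Strict Implicit.
Unset Printing Implicit Defensive.
Context {R : realType}.
Local Open Scope complex_scope.
Local Notation C := (Cplx R).
Implicit Types (x y z : C) (e : R).

(** The norm of [Cplx R] takes values in [Cplx R], whose order is partial;
    estimates are carried out with this real-valued version instead. *)
Definition modulus (z : C) : R := complex.Re `|z|.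

Lemma normr_modulus z : `|z| = (modulus z)%:C.
Proof. by rewrite /modulus (RRe_real (normr_real z)). Qed.

Lemma modulus_ge0 z : 0 <= modulus z.
Proof. by rewrite -lecR -normr_modulus normr_ge0. Qed.

Lemma modulus0 : modulus 0 = 0.
Proof. by rewrite /modulus normr0. Qed.

Lemma modulus1 : modulus 1 = 1.
Proof. by rewrite /modulus normr1. Qed.

Lemma modulus_eq0 z : (modulus z == 0) = (z == 0).
Proof.
rewrite -(normr_eq0 z) normr_modulus; apply/eqP/eqP => [->|] //.
exact: (@complexI R _ 0).
Qed.

Lemma modulus_gt0 z : (0 < modulus z) = (z != 0).
Proof. by rewrite lt_def modulus_ge0 modulus_eq0 andbT. Qed.

Lemma modulusM x y : modulus (x * y) = modulus x * modulus y.
Proof. by apply: complexI; rewrite rmorphM /= -!normr_modulus normrM. Qed.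

Lemma modulusX z n : modulus (z ^+ n) = modulus z ^+ n.
Proof. by elim: n => [|n IH]; rewrite ?modulus1 // !exprS modulusM IH. Qed.

Lemma modulusV z : modulus z^-1 = (modulus z)^-1.
Proof. by apply: complexI; rewrite fmorphV /= -!normr_modulus normfV. Qed.

Lemma modulusN z : modulus (- z) = modulus z.
Proof. by rewrite /modulus normrN. Qed.

Lemma modulus_distC x y : modulus (x - y) = modulus (y - x).
Proof. by rewrite -modulusN opprB. Qed.

Lemma modulusD x y : modulus (x + y) <= modulus x + modulus y.
Proof. by rewrite -lecR rmorphD /= -!normr_modulus ler_normD. Qed.

Lemma modulus_triangle y x z : modulus (x - z) <= modulus (x - y) + modulus (y - z).
Proof. by have := modulusD (x - y) (y - z); rewrite addrA subrK. Qed.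

Lemma modulus_sub_le x y : modulus x - modulus y <= modulus (x - y).
Proof. by have := modulusD (x - y) y; rewrite subrK; lra. Qed.

Lemma modulus_sum (I : Type) (r : seq I) (P : pred I) (F : I -> C) :
  modulus (\sum_(i <- r | P i) F i) <= \sum_(i <- r | P i) modulus (F i).
Proof.
elim/big_ind2 : _ => [|x a y b xa yb|//]; first by rewrite modulus0.
exact: le_trans (modulusD _ _) (lerD xa yb).
Qed.

Lemma modulus_natr n : modulus n%:R = n%:R.
Proof. by apply: complexI; rewrite -normr_modulus normr_nat rmorph_nat. Qed.

Lemma modulus_real (t : R) : modulus t%:C = `|t|.
Proof. by rewrite /modulus normc_def /= expr0n addr0 sqrtr_sqr. Qed.

Lemma modulus_radial_sub (t : R) z :
  modulus z = 1 -> modulus (t%:C * z - z) = `|t - 1|.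
Proof.
move=> z1; rewrite -{2}[z]mul1r -mulrBl modulusM z1 mulr1.
by rewrite -(rmorph1 (real_complex R)) -rmorphB modulus_real.
Qed.

Lemma modulus_Re z : `|complex.Re z| <= modulus z.
Proof.
rewrite /modulus normc_def /= -sqrtr_sqr ler_wsqrtr // lerDl; exact: sqr_ge0.
Qed.

Lemma modulus_Im z : `|complex.Im z| <= modulus z.
Proof.
rewrite /modulus normc_def /= -sqrtr_sqr ler_wsqrtr // lerDr; exact: sqr_ge0.
Qed.

Lemma modulus_ReIm_le z :
  modulus z <= `|complex.Re z| + `|complex.Im z|.
Proof.
case: z => a b.
have ab : (a +i* b : C) = a%:C + b%:C * 'i :> C.
  by rewrite [LHS]complexE /= mulrC.
rewrite {1}ab; apply: le_trans (modulusD _ _) _.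
rewrite modulusM !modulus_real.
have -> : modulus 'i = 1 by rewrite /modulus normc_def /= expr0n add0r expr1n sqrtr1.
by rewrite mulr1.
Qed.

Lemma ballE (p : C) (e : C) z : ball p e z = (`|p - z| < e) :> Prop.
Proof. by []. Qed.

Lemma ball_modulus (p : C) e z : ball p e%:C z <-> modulus (z - p) < e.
Proof. by rewrite ballE normr_modulus ltcR modulus_distC. Qed.

Lemma pos_complex_real (e : C) : 0 < e -> exists2 r : R, 0 < r & e = r%:C.
Proof.
move=> e0; have /complex_realP[r er] := gtr0_real e0.
by exists r => //; rewrite -ltcR -er.
Qed.

Lemma cvg_modulusP (T : Type) (F : set_system T) {FF : Filter F}
    (f : T -> C) (l : C) :
  f @ F --> l <-> forall e, 0 < e -> \forall t \near F, modulus (l - f t) < e.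
Proof.
split=> [/cvgrPdist_lt fl e e0|fl].
  have /fl : (0 : C) < e%:C by rewrite ltcR.
  by apply: filterS => t; rewrite normr_modulus ltcR.
apply/cvgrPdist_lt => _ /pos_complex_real[e e0 ->].
by apply: filterS (fl e e0) => t; rewrite normr_modulus ltcR.
Qed.

Lemma cvg_modulus (T : Type) (F : set_system T) {FF : Filter F}
    (f : T -> C) (l : C) : f @ F --> l -> (modulus \o f) @ F --> modulus l.
Proof.
move=> /cvg_modulusP fl; apply/cvgrPdist_lt => e e0.
apply: filterS (fl e e0) => t; apply: le_lt_trans.
have := modulus_sub_le l (f t); have := modulus_sub_le (f t) l.
by rewrite modulus_distC /= ler_norml; lra.
Qed.

Lemma cvg_unique_complex (u : C^nat) (l l' : C) :
  u @ \oo --> l -> u @ \oo --> l' -> l = l'.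
Proof. by move=> ul ul'; exact: (cvg_unique _ ul ul'). Qed.

(** Completeness of the complex numbers, inherited from that of the reals
    through the real and imaginary parts, in the form that an explicit error
    bound provides. *)
Lemma complex_cauchy_rate_cvg (u : C^nat) (e : R^nat) :
  (forall m n, (m <= n)%N -> modulus (u n - u m) <= e m) -> e @ \oo --> 0 ->
  cvgn u.
Proof.
move=> ue e0.
have real_cvg (p : C -> R) : {morph p : x y / x - y} ->
    (forall z, `|p z| <= modulus z) -> cvgn (p \o u).
  move=> pB ple; apply/cauchy_cvgP/cauchy_exP => d d0.
  move/cvgrPdist_lt : e0 => /(_ _ d0)[N _ eN].
  exists (p (u N)), N => // n /= Nn.
  change (`|p (u N) - p (u n)| < d); rewrite distrC -pB.
  apply: le_lt_trans (ple _) (le_lt_trans (ue _ _ Nn) _).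
  by have := eN N (leqnn _); rewrite /= sub0r normrN; exact/le_lt_trans/ler_norm.
have /cvg_ex[a ua] : cvgn ((@complex.Re R : C -> R) \o u).
  by apply: real_cvg; [case=> ? ?; case | exact: modulus_Re].
have /cvg_ex[b ub] : cvgn ((@complex.Im R : C -> R) \o u).
  by apply: real_cvg; [case=> ? ?; case | exact: modulus_Im].
apply/cvg_ex; exists (a +i* b); apply/cvg_modulusP => d d0.
have d20 : 0 < d / 2 by lra.
move/cvgrPdist_lt : ua => /(_ _ d20) ua; move/cvgrPdist_lt : ub => /(_ _ d20) ub.
near=> n; apply: le_lt_trans (modulus_ReIm_le _) _.
have : `|a - complex.Re (u n)| < d / 2 by near: n.
have : `|b - complex.Im (u n)| < d / 2 by near: n.
by case: (u n) => x y /=; lra.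
Unshelve. all: by end_near. Qed.

End Modulus.

(** * Geometric majorants *)

Lemma sum_geometric_telescope (K : pzRingType) (q : K) M N : (M <= N)%N ->
  (\sum_(M <= n < N) q ^+ n) * (1 - q) = q ^+ M - q ^+ N.
Proof.
move=> MN; rewrite -(subnKC MN); elim: (N - M)%N => [|d IH].
  by rewrite addn0 big_geq // mul0r subrr.
rewrite addnS big_nat_recr ?leq_addr //= mulrDl IH mulrBr mulr1 -exprSr.
by rewrite addrA subrK.
Qed.

Section Majorants.
Set Implicit Arguments.
Unset Strict Implicit.
Unset Printing Implicit Defensive.
Context {R : realType}.
Local Notation C := (Cplx R).
Implicit Types (c : C^nat) (s t q M : R).

Lemma sum_geometric_le q N K : 0 <= q -> q < 1 ->
  \sum_(N <= n < K) q ^+ n <= q ^+ N / (1 - q).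
Proof.
move=> q0 q1; have q1' : 0 < 1 - q by lra.
have [KN|NK] := leqP K N.
  by rewrite big_geq // divr_ge0 ?exprn_ge0 // ltW.
by rewrite ler_pdivlMr // sum_geometric_telescope 1?ltnW // gerBl exprn_ge0.
Qed.

(** Quantitative substitute for the radius of convergence: it makes the series
    converge where |z - p| < s, with explicit tails, and by [cvg_coef_bound]
    every s below the radius of convergence has such an M. *)
Definition coef_bound c s M := forall n, modulus (c n) * s ^+ n <= M.

(** The sum of M q^n over n >= N. *)
Definition geometric_tail M q (N : nat) : R := M * q ^+ N / (1 - q).

Lemma cvg_geometric_tail M q : 0 <= q -> q < 1 ->
  geometric_tail M q @ \oo --> 0.
Proof.
move=> q0 q1.
have -> : geometric_tail M q = geometric (M / (1 - q)) q.
  by apply/funext => N; rewrite /geometric_tail /geometric /= mulrAC.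
by apply: cvg_geometric; rewrite ger0_norm.
Qed.

Lemma coef_bound_ge0 c s M : coef_bound c s M -> 0 <= M.
Proof. by move=> /(_ 0%N); rewrite expr0 mulr1; apply: le_trans (modulus_ge0 _). Qed.

Lemma coef_bound_tail c s M t N K :
  coef_bound c s M -> 0 < s -> 0 <= t -> t < s ->
  \sum_(N <= n < K) modulus (c n) * t ^+ n <= geometric_tail M (t / s) N.
Proof.
move=> cM s0 t0 ts.
have q0 : 0 <= t / s by rewrite divr_ge0 // ltW.
have q1 : t / s < 1 by rewrite ltr_pdivrMr // mul1r.
apply: le_trans (_ : \sum_(N <= n < K) M * (t / s) ^+ n <= _).
  apply: ler_sum => n _.
  have -> : t ^+ n = s ^+ n * (t / s) ^+ n.
    by rewrite -exprMn mulrCA divff ?mulr1 // lt0r_neq0.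
  by rewrite mulrA ler_wpM2r ?exprn_ge0.
rewrite -mulr_sumr /geometric_tail -mulrA ler_wpM2l //.
  exact: coef_bound_ge0 cM.
exact: sum_geometric_le.
Qed.

Lemma power_seriesE c (p z : C) N :
  power_series c p z N = \sum_(0 <= n < N) c n * (z - p) ^+ n.
Proof. by []. Qed.

Lemma power_series_dist c (p z : C) s M N K : coef_bound c s M ->
  modulus (z - p) < s -> (N <= K)%N ->
  modulus (power_series c p z K - power_series c p z N)
    <= geometric_tail M (modulus (z - p) / s) N.
Proof.
move=> cM zs NK.
have s0 : 0 < s by apply: le_lt_trans zs; exact: modulus_ge0.
rewrite !power_seriesE (big_cat_nat _ NK) //= addrAC subrr add0r.
apply: le_trans (modulus_sum _ _ _) _.
apply: le_trans (coef_bound_tail N K cM s0 (modulus_ge0 _) zs).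
by apply: ler_sum => n _; rewrite modulusM modulusX.
Qed.

Lemma ratio_itv t s : 0 <= t -> t < s -> 0 <= t / s /\ t / s < 1.
Proof.
move=> t0 ts; have s0 : 0 < s by exact: le_lt_trans ts.
by rewrite divr_ge0 ?ltr_pdivrMr ?mul1r // ltW.
Qed.

Lemma power_series_cvg c (p z : C) s M : coef_bound c s M ->
  modulus (z - p) < s -> cvgn (power_series c p z).
Proof.
move=> cM zs; have [q0 q1] := ratio_itv (modulus_ge0 _) zs.
apply: (complex_cauchy_rate_cvg (e := geometric_tail M (modulus (z - p) / s))).
  by move=> m n; exact: power_series_dist.
exact: cvg_geometric_tail.
Qed.

Lemma power_series_modulus c (p z : C) s M N : coef_bound c s M ->
  modulus (z - p) < s ->
  modulus (power_series c p z N) <= geometric_tail M (modulus (z - p) / s) 0.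
Proof.
move=> cM zs; have := power_series_dist cM zs (leq0n N).
by rewrite [X in _ - X]power_seriesE big_geq // subr0.
Qed.

Lemma modulus_lim_le (u : C^nat) (l : C) (B : R) (N : nat) :
  u @ \oo --> l -> (forall n, (N <= n)%N -> modulus (u n) <= B) ->
  modulus l <= B.
Proof.
move=> /cvg_modulus ul uB.
rewrite -(cvg_lim _ ul) //; apply: limr_le; first by apply/cvg_ex; eexists; exact: ul.
by exists N => // n /= Nn; exact: uB.
Qed.

Lemma modulus_lim_ge (u : C^nat) (l : C) (B : R) (N : nat) :
  u @ \oo --> l -> (forall n, (N <= n)%N -> B <= modulus (u n)) ->
  B <= modulus l.
Proof.
move=> /cvg_modulus ul uB.
rewrite -(cvg_lim _ ul) //; apply: limr_ge; first by apply/cvg_ex; eexists; exact: ul.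
by exists N => // n /= Nn; exact: uB.
Qed.

(** The terms of a convergent series tend to 0, hence are bounded; the point
    at distance s of the centre may be any, and is taken on the real line. *)
Lemma cvg_coef_bound c (p : C) s (l : C) : 0 < s ->
  power_series c p (p + real_complex R s) @ \oo --> l ->
  exists M, coef_bound c s M.
Proof.
move=> s0 cl.
have /cvg_modulus t0 : (fun n => c n * (p + real_complex R s - p) ^+ n) @ \oo --> (0 : C).
  by apply: cvg_series_cvg_0; apply/cvg_ex; exists l.
have /cvg_seq_bounded[M [_ /(_ (M + 1))]] :
    cvgn (modulus \o (fun n => c n * (p + real_complex R s - p) ^+ n)).
  by apply/cvg_ex; eexists; exact: t0.
rewrite ltrDl ltr01 => /(_ isT) cM; exists (M + 1) => n.
have := cM n I; rewrite /= addrAC subrr add0r modulusM modulusX modulus_real.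
rewrite (gtr0_norm s0) ger0_norm // mulr_ge0 ?modulus_ge0 // exprn_ge0 //.
exact: ltW.
Qed.

End Majorants.

(** * Recentring a power series *)

Section TaylorShift.
Set Implicit Arguments.
Unset Strict Implicit.
Unset Printing Implicit Defensive.
Context {R : realType}.
Local Notation C := (Cplx R).
Implicit Types (c : C^nat) (p w x y z : C) (s b M : R).

(** The k-th Taylor coefficient, at displacement x from the centre, of the
    polynomial truncated at degree N.  The terms with n < k vanish
    through the binomial coefficient. *)
Definition taylor_sum c x (k N : nat) : C :=
  \sum_(0 <= n < N) c n * x ^+ (n - k) *+ 'C(n, k).

Definition taylor_coef c x (k : nat) : C := limn (taylor_sum c x k).

Lemma binomial_partial_sum_le (a b : R) K n : 0 <= a -> 0 <= b ->
  \sum_(0 <= k < K) (a ^+ (n - k) * b ^+ k) *+ 'C(n, k) <= (a + b) ^+ n.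
Proof.
move=> a0 b0.
have F0 k : 0 <= (a ^+ (n - k) * b ^+ k) *+ 'C(n, k).
  by rewrite mulrn_wge0 // mulr_ge0 // exprn_ge0.
rewrite exprDn -(big_mkord xpredT (fun k => (a ^+ (n - k) * b ^+ k) *+ 'C(n, k))).
have [Kn|nK] := leqP K n.+1.
  by rewrite [leRHS](big_cat_nat _ Kn) //= lerDl sumr_ge0.
rewrite (big_cat_nat _ (ltnW nK)) //= [X in _ + X]big_nat [X in _ + X]big1 ?addr0 // => k.
by move=> /andP[nk _]; rewrite bin_small // mulr0n.
Qed.

(** Recentring a polynomial is exact.  Bounding the effect of truncation on
    all coefficients at once, as [taylor_sum_dist] does, then replaces the
    interchange of two infinite sums. *)
Lemma sum_taylor_sum c x y N :
  \sum_(0 <= k < N) taylor_sum c x k N * y ^+ k =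
  \sum_(0 <= n < N) c n * (x + y) ^+ n.
Proof.
under eq_bigr do rewrite mulr_suml.
rewrite exchange_big /= !big_nat; apply: eq_bigr => n /andP[_ nN].
rewrite exprDn mulr_sumr -(big_mkord xpredT (fun k => c n * (x ^+ (n - k) * y ^+ k *+ 'C(n, k)))).
rewrite (big_cat_nat _ nN) //= [X in _ + X]big_nat [X in _ + X]big1 ?addr0 => [|k /andP[nk _]].
  by apply: eq_bigr => k _; rewrite mulrnAl -mulrA mulrnAr.
by rewrite bin_small // mulr0n mul0r.
Qed.

(** The terms of degree at least N contribute to the k-th coefficient at most
    the sum of |c_n| 'C(n, k) |x|^(n-k); weighting by b^k and summing over k
    turns this, by the binomial formula, into a tail of the series at |x| + b. *)
Lemma taylor_sum_dist c x b s M K N N' :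
  coef_bound c s M -> 0 <= b -> modulus x + b < s -> (N <= N')%N ->
  \sum_(0 <= k < K) modulus (taylor_sum c x k N' - taylor_sum c x k N) * b ^+ k
    <= geometric_tail M ((modulus x + b) / s) N.
Proof.
move=> cM b0 xbs NN'.
have x0 := modulus_ge0 x; have xb0 : 0 <= modulus x + b by lra.
have s0 : 0 < s by lra.
apply: le_trans (coef_bound_tail N N' cM s0 xb0 xbs).
apply: le_trans (_ : \sum_(0 <= k < K) \sum_(N <= n < N')
    modulus (c n) * (modulus x ^+ (n - k) * b ^+ k *+ 'C(n, k)) <= _).
  apply: ler_sum => k _.
  rewrite /taylor_sum (big_cat_nat _ NN') //= addrAC subrr add0r.
  apply: le_trans (ler_wpM2r (exprn_ge0 _ b0) (modulus_sum _ _ _)) _.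
  rewrite mulr_suml; apply: ler_sum => n _.
  rewrite -mulr_natr !modulusM modulusX modulus_natr -[in leRHS]mulr_natr.
  by rewrite -!mulrA (mulrC (b ^+ k)).
rewrite exchange_big /=; apply: ler_sum => n _.
by rewrite -mulr_sumr ler_wpM2l ?modulus_ge0 // binomial_partial_sum_le.
Qed.

Lemma taylor_sum_dist1 c x b s M k N N' :
  coef_bound c s M -> 0 <= b -> modulus x + b < s -> (N <= N')%N ->
  modulus (taylor_sum c x k N' - taylor_sum c x k N) * b ^+ k
    <= geometric_tail M ((modulus x + b) / s) N.
Proof.
move=> cM b0 xbs NN'; apply: le_trans (taylor_sum_dist k.+1 cM b0 xbs NN').
rewrite big_nat_recr //= lerDr sumr_ge0 // => i _.
by rewrite mulr_ge0 ?modulus_ge0 // exprn_ge0.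
Qed.

Lemma taylor_sum_cvg c x s M k : coef_bound c s M -> modulus x < s ->
  taylor_sum c x k @ \oo --> taylor_coef c x k.
Proof.
move=> cM xs; have x0 := modulus_ge0 x.
pose b := (s - modulus x) / 2.
have b0 : 0 < b by rewrite /b; lra.
have xbs : modulus x + b < s by rewrite /b; lra.
have xb0 : 0 <= modulus x + b by rewrite /b; lra.
have [q0 q1] := ratio_itv xb0 xbs.
suff : cvgn (taylor_sum c x k) by [].
apply: (complex_cauchy_rate_cvg
  (e := fun N => geometric_tail M ((modulus x + b) / s) N / b ^+ k)).
  move=> m n mn; rewrite ler_pdivlMr ?exprn_gt0 //.
  exact: taylor_sum_dist1 cM (ltW b0) xbs mn.
rewrite -[X in _ --> X](mul0r (b ^+ k)^-1).
by apply: cvgM; [exact: cvg_geometric_tail | exact: cvg_cst].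
Qed.

Lemma taylor_coef_dist c x b s M K N :
  coef_bound c s M -> 0 <= b -> modulus x + b < s ->
  \sum_(0 <= k < K) modulus (taylor_coef c x k - taylor_sum c x k N) * b ^+ k
    <= geometric_tail M ((modulus x + b) / s) N.
Proof.
move=> cM b0 xbs; have x0 := modulus_ge0 x.
have xs : modulus x < s by lra.
have S_cvg : (fun N' => \sum_(0 <= k < K)
    modulus (taylor_sum c x k N' - taylor_sum c x k N) * b ^+ k) @ \oo -->
    \sum_(0 <= k < K) modulus (taylor_coef c x k - taylor_sum c x k N) * b ^+ k.
  apply: cvg_big => [|k _]; first exact: add_continuous.
  apply: cvgM; last exact: cvg_cst.
  apply: (cvg_modulus (f := fun N' => _ - _)).
  by apply: cvgB; [exact: taylor_sum_cvg cM xs | exact: cvg_cst].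
rewrite -(cvg_lim _ S_cvg) //; apply: limr_le.
  by apply/cvg_ex; eexists; exact: S_cvg.
by exists N => // n /= Nn; exact: taylor_sum_dist.
Qed.

Lemma power_series_shift c p w z s M (l : C) :
  coef_bound c s M -> modulus (w - p) + modulus (z - w) < s ->
  power_series c p z @ \oo --> l ->
  power_series (taylor_coef c (w - p)) w z @ \oo --> l.
Proof.
move=> cM wzs cl.
set q := (modulus (w - p) + modulus (z - w)) / s.
have [q0 q1] : 0 <= q /\ q < 1.
  by apply: ratio_itv => //; rewrite addr_ge0 ?modulus_ge0.
have dist N : modulus (power_series c p z N
    - power_series (taylor_coef c (w - p)) w z N) <= geometric_tail M q N.
  apply: le_trans (taylor_coef_dist N N cM (modulus_ge0 _) wzs).
  rewrite modulus_distC !power_seriesE.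
  have -> : z - p = (w - p) + (z - w) by rewrite [RHS]addrC addrA subrK.
  rewrite -(sum_taylor_sum c) -sumrB; apply: le_trans (modulus_sum _ _ _) _.
  by apply: ler_sum => k _; rewrite -mulrBl modulusM modulusX.
apply/cvg_modulusP => e e0; have e20 : 0 < e / 2 by lra.
move/cvg_modulusP : cl => /(_ _ e20) cl.
have /cvgrPdist_lt/(_ _ e20) tl := cvg_geometric_tail M q0 q1.
near=> N; apply: le_lt_trans (modulus_triangle (power_series c p z N) _ _) _.
have : modulus (l - power_series c p z N) < e / 2 by near: N.
have : `|0 - geometric_tail M q N| < e / 2 by near: N.
have := dist N; have := ler_norm (geometric_tail M q N).
by rewrite sub0r normrN; lra.
Unshelve. all: by end_near. Qed.

(** A power series converges, to the same function, after being recentred at w: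
    at least on the largest disk about w inside the original one. *)
Lemma power_series_recenter c p (r : R) (g : C -> C) w z :
  (forall y, modulus (y - p) < r -> power_series c p y @ \oo --> g y) ->
  modulus (w - p) + modulus (z - w) < r ->
  power_series (taylor_coef c (w - p)) w z @ \oo --> g z.
Proof.
move=> cg wzr.
pose s := (modulus (w - p) + modulus (z - w) + r) / 2.
have wp0 := modulus_ge0 (w - p); have zw0 := modulus_ge0 (z - w).
have s0 : 0 < s by rewrite /s; lra.
have [|M cM] := @cvg_coef_bound _ c p s (g (p + real_complex R s)) s0.
  apply: cg; rewrite addrAC subrr add0r modulus_real gtr0_norm // /s; lra.
apply: (power_series_shift cM); first by rewrite /s; lra.
apply: cg; apply: le_lt_trans (modulus_triangle w _ _) _; lra.
Qed.

(** If d_k is the first nonzero coefficient, then d_k t^k cancels the sum of the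
    later terms, which is of order t^(k+1) as t tends to 0. *)
Lemma power_series_eq0 (d : C^nat) (r : R) : 0 < r ->
  (forall y, modulus y < r -> power_series d 0 y @ \oo --> (0 : C)) ->
  forall k, d k = 0.
Proof.
move=> r0 d0 k.
pose s := r / 2; have s0 : 0 < s by rewrite /s; lra.
have [|M dM] := @cvg_coef_bound _ d 0 s 0 s0.
  apply: d0; rewrite add0r modulus_real gtr0_norm // /s; lra.
have M0 := coef_bound_ge0 dM.
elim/ltn_ind: k => k IH; apply/eqP; rewrite -modulus_eq0; apply/negP => /negP dk.
have dk0 : 0 < modulus (d k) by rewrite lt_def dk modulus_ge0.
have key t : 0 < t -> t <= s / 2 -> modulus (d k) * s ^+ k.+1 <= 2 * M * t.
  move=> t0 ts.
  have ts' : t < s by lra.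
  have q12 : t / s <= 2^-1 by rewrite ler_pdivrMr //; lra.
  have dtr : modulus (real_complex R t : C) < r.
    by rewrite modulus_real gtr0_norm // /s in ts *; lra.
  have : modulus (0 - d k * (real_complex R t : C) ^+ k)
      <= geometric_tail M (t / s) k.+1.
    apply: (modulus_lim_le (N := k.+1) (u := fun N => power_series d 0 (real_complex R t) N
      - d k * (real_complex R t : C) ^+ k)).
      by apply: cvgB; [exact: d0 | exact: cvg_cst].
    move=> n kn; rewrite power_seriesE (big_cat_nat _ kn) //= big_nat_recr //=.
    rewrite big_nat big1 => [|i /andP[_ ik]]; last by rewrite IH // mul0r.
    rewrite add0r subr0 addrAC subrr add0r.
    apply: le_trans (modulus_sum _ _ _) _.
    apply: le_trans (coef_bound_tail k.+1 n dM s0 (ltW t0) ts').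
    apply: ler_sum => i _.
    by rewrite ?subr0 modulusM modulusX modulus_real (gtr0_norm t0).
  rewrite sub0r modulusN modulusM modulusX modulus_real (gtr0_norm t0).
  have tail_le : geometric_tail M (t / s) k.+1 <= 2 * M * (t / s) ^+ k.+1.
    have q1 : 0 < 1 - t / s by lra.
    rewrite /geometric_tail ler_pdivrMr // -mulrA.
    have : 0 <= M * (t / s) ^+ k.+1.
      by rewrite mulr_ge0 // exprn_ge0 // divr_ge0 // ltW.
    nra.
  move=> /le_trans/(_ tail_le).
  rewrite exprMn exprVn mulrA ler_pdivlMr ?exprn_gt0 // (exprSr t).
  have tk : 0 < t ^+ k by rewrite exprn_gt0.
  move=> H; rewrite -(ler_pM2r tk) mulrAC; apply: le_trans H _; rewrite -!mulrA (mulrC t); exact: lexx.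
have X0 : 0 < modulus (d k) * s ^+ k.+1 by rewrite mulr_gt0 ?exprn_gt0.
set X := modulus _ * _ in key X0.
(* X <= 2 M t fails for this t; M + 1 replaces M, which may be 0. *)
pose t := Num.min (s / 2) (X / (4 * (M + 1))).
have t0 : 0 < t by rewrite lt_min !divr_gt0 //; lra.
have := key t t0; rewrite ge_min lexx => /(_ isT).
have : t <= X / (4 * (M + 1)) by rewrite ge_min lexx orbT.
rewrite ler_pdivlMr; last by lra.
nra.
Qed.

Lemma power_series_unique c c' p (r : R) (f : C -> C) : 0 < r ->
  (forall z, modulus (z - p) < r -> power_series c p z @ \oo --> f z) ->
  (forall z, modulus (z - p) < r -> power_series c' p z @ \oo --> f z) ->
  c = c'.
Proof.
move=> r0 cf c'f; apply/funext => k; apply/eqP; rewrite -subr_eq0; apply/eqP.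
apply: (@power_series_eq0 (fun k => c k - c' k) r r0) => y yr.
have yr' : modulus (p + y - p) < r by rewrite addrAC subrr add0r.
have -> : power_series (fun k => c k - c' k) 0 y =
    (fun N => power_series c p (p + y) N - power_series c' p (p + y) N).
  apply/funext => N; rewrite !power_seriesE -sumrB; apply: eq_bigr => n _.
  by rewrite -mulrBl subr0 addrAC subrr add0r.
by rewrite -(subrr (f (p + y))); apply: cvgB; [exact: cf | exact: c'f].
Qed.

End TaylorShift.

(** * Continuation across the circle and overconvergence *)

Section Continuation.
Context {R : realType}.
Set Implicit Arguments.
Unset Strict Implicit.
Unset Printing Implicit Defensive.
Local Open Scope complex_scope.
Local Notation C := (Cplx R).
Implicit Types (a c : C^nat) (p w x y z : C) (s A : R).

Lemma analytic_atP (f : C -> C) p : analytic_at f p <->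
  exists2 r : R, 0 < r & exists c, forall z, modulus (z - p) < r ->
    power_series c p z @ \oo --> f z.
Proof.
split=> [[_ [/pos_complex_real[r r0 ->] [c cf]]]|[r r0 [c cf]]].
  by exists r => //; exists c => z zr; apply: cf; apply/ball_modulus.
exists r%:C; split; first by rewrite ltcR.
by exists c => z /ball_modulus; exact: cf.
Qed.

Lemma unit_diskP z : unit_disk z <-> modulus z < 1.
Proof.
rewrite /unit_disk; have := ball_modulus (0 : C) 1 z.
by rewrite subr0.
Qed.

Lemma analytic_at_power_series c p (r : R) (g : C -> C) :
  (forall z, modulus (z - p) < r -> power_series c p z @ \oo --> g z) ->
  forall w, modulus (w - p) < r -> analytic_at g w.
Proof.
move=> cg w wr; apply/analytic_atP; exists (r - modulus (w - p)); first by lra.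
exists (taylor_coef c (w - p)) => z zw.
by apply: power_series_recenter cg _; lra.
Qed.

Definition continues_across_circle (h : C -> C) := exists z0 : C, `|z0| = 1 /\
  exists delta : C, 0 < delta /\
    exists g : C -> C, analytic_continuation unit_disk (ball z0 delta) h g.

(** As m grows the radius decreases to 1 - |w| and the bound increases, so that
    a single index m expresses that the Taylor series at w converges on a disk
    reaching outside the unit disk. *)
Definition overconverges c w (m : nat) := forall k,
  modulus (taylor_coef c w k) * (1 - modulus w + m.+1%:R^-1) ^+ k <= m%:R.

(** Polar decomposition; the direction of 0 is arbitrary. *)
Lemma unit_direction w : exists2 z0, modulus z0 = 1 & w = (modulus w)%:C * z0.
Proof.
have [->|w0] := eqVneq w 0.
  by exists 1; rewrite ?modulus1 // modulus0 mul0r.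
have mw0 : (modulus w)%:C != 0 :> C.
  by rewrite -modulus_eq0 modulus_real normr_eq0 modulus_eq0.
exists (w / (modulus w)%:C); last by rewrite mulrC divfK.
rewrite modulusM modulusV modulus_real ger0_norm ?modulus_ge0 // divff //.
by rewrite modulus_eq0.
Qed.

Definition rational_point (q : rat * rat) : C := ratr q.1 +i* ratr q.2.

Lemma rational_point_dense z s : 0 < s ->
  exists q, modulus (rational_point q - z) < s.
Proof.
move=> s0.
have approx (t : R) : exists q : rat, `|ratr q - t| < s / 2.
  have /rat_in_itvoo[q] : t - s / 2 < t + s / 2 by lra.
  by rewrite in_itv /= => qt; exists q; rewrite ltr_norml; lra.
have [p pP] := approx (complex.Re z); have [q qP] := approx (complex.Im z).
exists (p, q); apply: le_lt_trans (modulus_ReIm_le _) _.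
by case: z pP qP => b d /=; lra.
Qed.

Section BoundedCoefficients.
Variables (a : C^nat) (A : R).
Hypothesis aA : forall n, modulus (a n) <= A.
Local Notation f := (power_series_sum a).

Lemma bounded_coef_bound : coef_bound a 1 A.
Proof. by move=> n; rewrite expr1n mulr1. Qed.

Lemma power_series_sum_cvg z : modulus (z - 0) < 1 ->
  power_series a 0 z @ \oo --> f z.
Proof. exact: power_series_cvg bounded_coef_bound. Qed.

Lemma power_series_sum_analytic : analytic_on unit_disk f.
Proof.
move=> w /unit_diskP w1.
by apply: (analytic_at_power_series power_series_sum_cvg); rewrite subr0.
Qed.

Lemma power_series_sum_recenter w z : modulus w + modulus (z - w) < 1 ->
  power_series (taylor_coef a w) w z @ \oo --> f z.
Proof.
move=> wz; rewrite -[w in taylor_coef a w]subr0.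
by apply: power_series_recenter power_series_sum_cvg _; rewrite subr0.
Qed.

Lemma has_natural_boundaryP :
  has_natural_boundary f <-> ~ continues_across_circle f.
Proof.
split=> [[_ nb] [z0 [z01 cont]]|nb]; first exact: nb z0 z01 cont.
split; first exact: power_series_sum_analytic.
by move=> z0 z01 cont; apply: nb; exists z0.
Qed.

(** The Taylor series at w sums to some g on a disk about w that contains
    z0 = w/|w|; what has to be shown is that g agrees with f on the whole
    intersection of the unit disk with a neighbourhood of z0, not only on the
    disk about w inscribed in the unit disk.  Given z there, let w' be the
    point of modulus |w| on the ray through z.  It is close to w, so f and g
    agree around w' and have the same Taylor series at w'; this series
    converges to f and to g as far as 1 - |w|, hence at z. *)
Lemma overconverges_continues w m : modulus w < 1 -> overconverges a w m ->
  continues_across_circle f.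
Proof.
move=> w1 wm; set rho := 1 - modulus w + m.+1%:R^-1 in wm.
have w0 := modulus_ge0 w.
have rho1 : 1 - modulus w < rho by rewrite /rho ltrDl invr_gt0 ltr0n.
pose g z : C := limn (power_series (taylor_coef a w) w z).
have gP z : modulus (z - w) < rho ->
  power_series (taylor_coef a w) w z @ \oo --> g z.
  by apply: (power_series_cvg (M := m%:R)).
(* Both are sums of the Taylor series at w on the inscribed disk. *)
have fg y : modulus w + modulus (y - w) < 1 -> g y = f y.
  move=> yw; apply: cvg_unique_complex (power_series_sum_recenter yw).
  by apply: gP; lra.
have [z0 z01 wz0] := unit_direction w.
have wz0d : modulus (z0 - w) = 1 - modulus w.
  rewrite modulus_distC {1}wz0 modulus_radial_sub //.
  by rewrite distrC ger0_norm; lra.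
pose d := Num.min (rho - (1 - modulus w)) (1 - modulus w) / 2.
have d0 : 0 < d by rewrite divr_gt0 // lt_min; apply/andP; split; lra.
have drho : 2 * d <= rho - (1 - modulus w).
  by rewrite /d mulrCA divff ?mulr1 ?ge_min ?lexx.
have d1w : 2 * d <= 1 - modulus w.
  by rewrite /d mulrCA divff ?mulr1 ?ge_min ?lexx ?orbT.
exists z0; split; first by rewrite normr_modulus z01.
exists d%:C; split; first by rewrite ltcR.
exists g; split=> [z /ball_modulus zz0|z [/unit_diskP z1 /ball_modulus zz0]].
  apply: (analytic_at_power_series gP).
  by apply: le_lt_trans (modulus_triangle z0 _ _) _; lra.
have [u u1 zu] := unit_direction z.
set rz := modulus z in zu z1.
have zu1 : modulus (z - u) = 1 - rz.
  by rewrite {1}zu modulus_radial_sub // distrC ger0_norm; lra.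
have rz1 : 1 - rz < d.
  apply: le_lt_trans zz0; rewrite modulus_distC -z01; exact: modulus_sub_le.
pose w' : C := (modulus w)%:C * u.
have w'w : modulus (w' - w) < 2 * d.
  rewrite {1}wz0 -mulrBr modulusM modulus_real ger0_norm //.
  have : modulus (u - z0) < 2 * d.
    apply: le_lt_trans (modulus_triangle z _ _) _; rewrite modulus_distC; lra.
  have := modulus_ge0 (u - z0); nra.
have mw' : modulus w' = modulus w.
  by rewrite modulusM modulus_real u1 mulr1 ger0_norm.
have zw' : modulus (z - w') < 1 - modulus w.
  rewrite {1}zu -mulrBl -rmorphB modulusM modulus_real u1 mulr1.
  by rewrite ltr_norml; apply/andP; split; lra.
have same_coef : taylor_coef a w' = taylor_coef (taylor_coef a w) (w' - w).
  apply: (@power_series_unique _ _ _ w' (1 - modulus w - modulus (w' - w)) f).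
  - lra.
  - move=> y yw'; apply: power_series_sum_recenter.
    have := modulus_ge0 (w' - w); lra.
  move=> y yw'.
  rewrite -fg; first by apply: power_series_recenter gP _; lra.
  have := modulus_triangle w' y w; lra.
apply: (@cvg_unique_complex _ (power_series (taylor_coef a w') w' z)).
  by rewrite same_coef; apply: power_series_recenter gP _; lra.
by apply: power_series_sum_recenter; lra.
Qed.

(** The continuation is a power series at z0, with radius at least r say.
    Recentred at a rational w of the disk with |w - z0| < r/4, it converges up
    to distance 3r/4 from w, while 1 - |w| < r/4; and it is there the Taylor series
    of f, since the two agree around w. *)
Lemma continues_overconverges : continues_across_circle f ->
  exists q m, modulus (rational_point q) < 1 /\
    overconverges a (rational_point q) m.
Proof.
move=> [z0 [z01 [_ [/pos_complex_real[d d0 ->] [g [g_an gf]]]]]].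
have {}z01 : modulus z0 = 1 by rewrite /modulus z01.
have /g_an/analytic_atP[r' r'0 [c cg]] : ball z0 d%:C z0.
  by apply/ball_modulus; rewrite subrr modulus0.
pose r := Num.min (Num.min r' d) 1.
have r0 : 0 < r by rewrite !lt_min r'0 d0 ltr01.
have rr' : r <= r' by rewrite !ge_min lexx.
have rd : r <= d by rewrite !ge_min lexx orbT.
have r1 : r <= 1 by rewrite !ge_min lexx orbT.
(* Rational points within r/8 of v lie in the unit disk and near z0. *)
pose v : C := (1 - r / 8)%:C * z0.
have v1 : modulus v = 1 - r / 8.
  by rewrite modulusM modulus_real z01 mulr1 ger0_norm //; lra.
have vz0 : modulus (v - z0) = r / 8.
  by rewrite modulus_radial_sub // distrC ger0_norm; lra.
have [q] : exists q, modulus (rational_point q - v) < r / 8.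
  by apply: rational_point_dense; lra.
set w := rational_point q => wv.
have w1 : modulus w < 1 by have := modulus_sub_le w v; lra.
have wz0 : modulus (w - z0) < r / 4.
  by apply: le_lt_trans (modulus_triangle v _ _) _; lra.
have w_large : 1 - modulus w < r / 4.
  by apply: le_lt_trans wz0; rewrite modulus_distC -z01; exact: modulus_sub_le.
have wz0_ge0 := modulus_ge0 (w - z0).
have gw z : modulus (z - w) < r * (3 / 4) ->
    power_series (taylor_coef c (w - z0)) w z @ \oo --> g z.
  by move=> zw; apply: power_series_recenter cg _; lra.
have same_coef : taylor_coef a w = taylor_coef c (w - z0).
  apply: (@power_series_unique _ _ _ w (Num.min (1 - modulus w) (r * (3 / 4))) f).
  - by rewrite lt_min; apply/andP; split; lra.
  - move=> y; rewrite lt_min => /andP[yw _]; apply: power_series_sum_recenter; lra.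
  move=> y; rewrite lt_min => /andP[yw yr]; rewrite -gf; first exact: gw.
  split; [apply/unit_diskP|apply/ball_modulus].
    by have := modulus_sub_le y w; lra.
  by apply: le_lt_trans (modulus_triangle w _ _) _; lra.
have [||M cM] := @cvg_coef_bound _ (taylor_coef a w) w (r / 2) (g (w + (r / 2)%:C)).
- lra.
- rewrite same_coef; apply: gw; rewrite addrAC subrr add0r modulus_real.
  by rewrite gtr0_norm; lra.
have r40 : 0 < 4 / r by rewrite divr_gt0.
have [m mP] : exists m : nat, Num.max M (4 / r) <= m%:R.
  exists (Num.truncn (Num.max M (4 / r))).+1; apply: ltW; exact: truncnS_gt.
move: mP; rewrite ge_max => /andP[Mm rm].
exists q, m; split => // k; apply: le_trans (le_trans (cM k) Mm).
rewrite ler_wpM2l ?modulus_ge0 // lerXn2r ?nnegrE; try lra.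
  by rewrite addr_ge0 ?invr_ge0 ?ler0n //; lra.
have m1r : 4 / r < m.+1%:R by apply: le_lt_trans rm _; rewrite ltr_nat.
have : m.+1%:R^-1 < r / 4.
  by rewrite -(invf_div 4 r) ltf_pV2 ?posrE ?ltr0n.
by rewrite -/w; set i := m.+1%:R^-1; lra.
Qed.

End BoundedCoefficients.

(** * Sequences with a natural boundary form a G_delta *)

(** Truncation at degree N gives a continuous function of t, within an error that
    depends on A and N but not on t. *)
Lemma taylor_coef_continuous (T : topologicalType) (a : T -> C^nat) A x k :
  (forall n, continuous (fun t => a t n)) ->
  (forall t n, modulus (a t n) <= A) -> modulus x < 1 ->
  continuous (fun t => taylor_coef (a t) x k).
Proof.
move=> a_cont aA x1 t0; apply/cvg_modulusP => e e0.
have x0 := modulus_ge0 x.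
pose b := (1 - modulus x) / 2; have b0 : 0 < b by rewrite /b; lra.
have xb0 : 0 <= modulus x + b by lra.
have xb1 : modulus x + b < 1 by rewrite /b; lra.
have bk0 : 0 < b ^+ k by rewrite exprn_gt0.
have [q0 q1] := ratio_itv xb0 xb1.
have e1 : 0 < e / 4 * b ^+ k by rewrite mulr_gt0 //; lra.
have /cvgrPdist_lt/(_ _ e1)[N _ /(_ N (leqnn N))] := cvg_geometric_tail A q0 q1.
rewrite sub0r normrN => /(le_lt_trans (ler_norm _)) tailN.
have dist t : modulus (taylor_coef (a t) x k - taylor_sum (a t) x k N) <= e / 4.
  rewrite -(ler_pM2r bk0); apply: le_trans (ltW tailN).
  have := taylor_coef_dist k.+1 N (bounded_coef_bound (aA t)) (ltW b0) xb1.
  apply: le_trans; rewrite big_nat_recr //= lerDr sumr_ge0 // => i _.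
  by rewrite mulr_ge0 ?modulus_ge0 // exprn_ge0 // ltW.
have /cvg_modulusP/(_ (e / 4)) : (fun t => taylor_sum (a t) x k N) @ t0
    --> taylor_sum (a t0) x k N.
  apply: cvg_big => [|n _]; first exact: add_continuous.
  under eq_fun do rewrite -mulrnAr.
  by rewrite -mulrnAr; apply: cvgM; [exact: a_cont | exact: cvg_cst].
have e40 : 0 < e / 4 by lra.
move=> /(_ e40); apply: filterS => t tt0.
apply: le_lt_trans (modulus_triangle (taylor_sum (a t0) x k N) _ _) _.
have := modulus_triangle (taylor_sum (a t) x k N) (taylor_sum (a t0) x k N)
  (taylor_coef (a t) x k).
have := dist t; rewrite modulus_distC; have := dist t0; lra.
Qed.

Lemma Gdelta_bigcap_count (T : topologicalType) (J : countType)
  (U : J -> set T) : (forall i, open (U i)) -> Gdelta (\bigcap_i U i).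
Proof.
move=> Uo; exists (fun n => if unpickle n is Some i then U i else setT).
  by move=> n; case: unpickle => [i|]; [exact: Uo | exact: openT].
apply/seteqP; split=> t tU.
  by move=> n _; case: unpickle => // i; exact: tU.
by move=> i _; have := tU (pickle i) I; rewrite pickleK.
Qed.

Lemma overconverges_closed (T : topologicalType) (a : T -> C^nat) A x m :
  (forall n, continuous (fun t => a t n)) ->
  (forall t n, modulus (a t n) <= A) -> modulus x < 1 ->
  closed [set t | overconverges (a t) x m].
Proof.
move=> a_cont aA x1.
have -> : [set t | overconverges (a t) x m] = \bigcap_k
   ((fun t => modulus (taylor_coef (a t) x k) * (1 - modulus x + m.+1%:R^-1) ^+ k)
     @^-1` [set y : R | y <= m%:R]).
  apply/seteqP; split=> t /= tP; first by move=> k _; exact: tP.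
  by move=> k; exact: (tP k I).
apply: closed_bigI => k _; apply: preimage_closed; last exact: closed_le.
move=> t _; apply: cvgM; last exact: cvg_cst.
by apply: cvg_modulus; exact: taylor_coef_continuous.
Qed.

Lemma natural_boundary_Gdelta (T : topologicalType) (a : T -> C^nat) A :
  (forall n, continuous (fun t => a t n)) ->
  (forall t n, modulus (a t n) <= A) ->
  Gdelta [set t | has_natural_boundary (power_series_sum (a t))].
Proof.
move=> a_cont aA.
have -> : [set t | has_natural_boundary (power_series_sum (a t))] =
    \bigcap_(i : rat * rat * nat) [set t | modulus (rational_point i.1) < 1 ->
       ~ overconverges (a t) (rational_point i.1) i.2].
  apply/seteqP; split=> t /=.
    move=> /(has_natural_boundaryP (aA t)) nb i _ /= i1 io; apply: nb.
    exact: overconverges_continues (aA t) _ _ i1 io.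
  move=> nb; apply/(has_natural_boundaryP (aA t)).
  move=> /(continues_overconverges (aA t))[q [m [q1 qm]]].
  exact: (nb (q, m) I q1 qm).
apply: Gdelta_bigcap_count => -[q m] /=.
have [q1|q1] := boolP (modulus (rational_point q) < 1); last first.
  have -> : [set t | false -> ~ overconverges (a t) (rational_point q) m] = setT.
    by apply/seteqP; split.
  exact: openT.
have -> : [set t | true -> ~ overconverges (a t) (rational_point q) m] =
    ~` [set t | overconverges (a t) (rational_point q) m].
  by apply/seteqP; split=> t /= h; [exact: h | move=> _].
by apply: closed_openC; exact: overconverges_closed a_cont aA q1.
Qed.

End Continuation.

(** * Roots of unity of order a power of 2 are dense in the circle *)

Section DyadicRoots.
Context {R : realType}.
Set Implicit Arguments.
Unset Strict Implicit.
Unset Printing Implicit Defensive.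
Local Notation C := (Cplx R).
Implicit Types (u v z : C).

Lemma sqr_modulus z : modulus z ^+ 2 = complex.Re z ^+ 2 + complex.Im z ^+ 2.
Proof.
by rewrite /modulus normc_def /= sqr_sqrtr // addr_ge0 // sqr_ge0.
Qed.

Lemma parallelogram u v :
  modulus (u - v) ^+ 2 + modulus (u + v) ^+ 2 =
  2 * (modulus u ^+ 2 + modulus v ^+ 2).
Proof. by rewrite !sqr_modulus; case: u v => [a b] [c d] /=; ring. Qed.

Lemma unit_of_expr z n : (0 < n)%N -> z ^+ n = 1 -> modulus z = 1.
Proof.
move=> n0 /(congr1 modulus); rewrite modulusX modulus1 => /eqP.
by rewrite pexpr_eq1 ?modulus_ge0 // => /eqP.
Qed.

(** If zeta is close to u^2 and v^2 = zeta, then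
    |u - v| |u + v| = |u^2 - zeta|, while by the parallelogram law the larger
    of |u - v| and |u + v| is at least sqrt 2 >= 4/3; so v or - v is closer to u
    than zeta to u^2 by a factor 3/4.  Starting from zeta = -1 keeps the roots
    different from 1. *)
Lemma dyadic_root_near u n : modulus u = 1 ->
  exists zeta, [/\ zeta != 1, zeta ^+ (2 ^ n.+1) = 1 &
    modulus (u - zeta) <= 2 * (3 / 4) ^+ n].
Proof.
elim: n u => [|n IH] u u1.
  exists (-1); split; last 1 first.
  - by rewrite expr0 mulr1 opprK; apply: le_trans (modulusD _ _) _; rewrite u1 modulus1; lra.
  - by rewrite -subr_eq0 -opprD oppr_eq0 (_ : 1 + 1 = 2%:R) // pnatr_eq0.
  - by rewrite expn1 sqrrN expr1n.
have [|zeta [zeta1 zetaX near]] := IH (u ^+ 2); first by rewrite modulusX u1 expr1n.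
pose v := sqrtC zeta.
have v2 : v ^+ 2 = zeta by exact: sqrtCK.
have vX : v ^+ (2 ^ n.+2) = 1 by rewrite expnS exprM v2.
have v1 : modulus v = 1 by apply: unit_of_expr vX; rewrite expn_gt0.
have par := parallelogram u v; rewrite u1 v1 in par.
have prod : modulus (u - v) * modulus (u + v) <= 2 * (3 / 4) ^+ n.
  by rewrite -modulusM -subr_sqr v2.
have m0 := modulus_ge0 (u - v); have p0 := modulus_ge0 (u + v).
have e0 : 0 <= (3 / 4 : R) ^+ n by rewrite exprn_ge0.
have v_neq1 (w : C) : w ^+ 2 = zeta -> w != 1.
  by move=> w2; apply: contraNneq zeta1 => w1; rewrite -w2 w1 expr1n.
rewrite exprS; have [le|lt] := lerP (modulus (u - v)) (modulus (u + v)).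
  exists v; split => //; first exact: v_neq1.
  have : 4 / 3 <= modulus (u + v) by nra.
  nra.
exists (- v); split; first by apply: v_neq1; rewrite sqrrN.
  by rewrite expnS exprM sqrrN -exprM -expnS.
rewrite opprK.
have : 4 / 3 <= modulus (u - v) by nra.
nra.
Qed.

End DyadicRoots.

(** * A lacunary series has no continuation *)

Section Lacunary.
Context {R : realType}.
Set Implicit Arguments.
Unset Strict Implicit.
Unset Printing Implicit Defensive.
Local Notation C := (Cplx R).
Local Notation "t %:RC" := (real_complex R t : C) (at level 2, format "t %:RC").
Implicit Types (a c : C^nat) (z zeta alpha gamma : C).

Lemma bernoulli_sub (h : R) n : 0 <= h -> h <= 1 -> 1 - n%:R * h <= (1 - h) ^+ n.
Proof.
move=> h0 h1; elim: n => [|n IH]; first by rewrite mul0r subr0.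
have n0 : 0 <= n%:R :> R by rewrite ler0n.
by rewrite exprS -natr1; nra.
Qed.

Lemma count_pow2 J L :
  L%:R <= \sum_(2 ^ J <= n < 2 ^ (J + L)) (2%N.-nat n)%:R :> R.
Proof.
elim: L => [|L IH]; first by rewrite addn0 big_geq.
have le1 : (2 ^ J <= 2 ^ (J + L))%N by rewrite leq_exp2l // leq_addr.
have lt2 : (2 ^ (J + L) < 2 ^ (J + L.+1))%N by rewrite ltn_exp2l // addnS.
rewrite (big_cat_nat le1 (ltnW lt2)) /= [X in _ + X]big_ltn //.
rewrite pnatX pnat_id // -natr1 lerD // lerDl sumr_ge0 // => i _.
Qed.

Lemma analytic_locally_bounded (g : C -> C) zeta : analytic_at g zeta ->
  exists2 d : R, 0 < d & exists B, forall z, modulus (z - zeta) <= d ->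
    modulus (g z) <= B.
Proof.
move=> /analytic_atP[r r0 [c cg]].
have [||M cM] := @cvg_coef_bound _ c zeta (r / 2) (g (zeta + (r / 2)%:RC)).
- lra.
- by apply: cg; rewrite addrAC subrr add0r modulus_real gtr0_norm; lra.
exists (r / 4); first lra.
exists (2 * M) => z zr; have M0 := coef_bound_ge0 cM.
apply: (modulus_lim_le (N := 0) (cg z _)); first lra.
move=> n _; apply: le_trans (power_series_modulus n cM _) _; first lra.
have q12 : modulus (z - zeta) / (r / 2) <= 2^-1 by rewrite ler_pdivrMr; lra.
rewrite /geometric_tail expr0 mulr1 ler_pdivrMr; last lra.
nra.
Qed.

Lemma sum_unit_geometric_le (z : C) N K : modulus z <= 1 -> z != 1 ->
  modulus (\sum_(N <= n < K) z ^+ n) <= 2 / modulus (1 - z).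
Proof.
move=> z1 zn1; have [KN|/ltnW NK] := leqP K N.
  by rewrite big_geq // modulus0 divr_ge0 ?modulus_ge0.
have z1_gt0 : 0 < modulus (1 - z) by rewrite modulus_gt0 subr_eq0 eq_sym.
rewrite ler_pdivlMr // -modulusM.
rewrite sum_geometric_telescope //.
have Xle n : modulus (z ^+ n) <= 1.
  by rewrite modulusX exprn_ile1 // modulus_ge0.
apply: le_trans (modulusD _ _) _; rewrite modulusN.
have := Xle N; have := Xle K; lra.
Qed.

Section PowersOfTwo.
Variables (a : C^nat) (A : R) (N0 : nat) (alpha gamma : C).
Hypothesis aA : forall n, modulus (a n) <= A.
Hypothesis aE : forall n, (N0 <= n)%N -> a n = alpha + gamma * (2%N.-nat n)%:R.
Local Notation f := (power_series_sum a).

(** On the radius through zeta, the terms of the powers of 2 beyond 2^J are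
    gamma t^n with t > 0, hence do not cancel; L of them have exponent below
    2^(J + L).  The remaining terms are bounded: finitely many, and
    a piece of a geometric series whose ratio stays away from 1. *)
Lemma lacunary_radial_growth zeta j : zeta != 1 -> zeta ^+ (2 ^ j) = 1 ->
  exists J B, forall L (t : R), 0 < t -> t < 1 ->
    modulus gamma * (t ^+ (2 ^ (J + L)) * L%:R) <= modulus (f (t%:RC * zeta)) + B.
Proof.
move=> zeta1 zetaX.
have mzeta : modulus zeta = 1 by apply: unit_of_expr zetaX; rewrite expn_gt0.
pose J := maxn j N0; pose N1 := (2 ^ J)%N.
have N01 : (N0 <= N1)%N.
  by apply: leq_trans (leq_maxr j N0) _; exact/ltnW/ltn_expl.
have root n : (N1 <= n)%N -> 2%N.-nat n -> zeta ^+ n = 1.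
  move=> N1n /p_natP[k nk]; rewrite {}nk in N1n *.
  rewrite leq_exp2l // in N1n.
  have jk : (j <= k)%N by apply: leq_trans N1n; exact: leq_maxl.
  by rewrite -(subnKC jk) expnD exprM zetaX expr1n.
pose B0 := \sum_(0 <= n < N1) modulus (a n).
pose B1 := modulus alpha * (4 / modulus (1 - zeta)).
exists J, (B0 + B1) => L t t0 t1.
set z := t%:RC * zeta.
have zm : modulus z = t by rewrite modulusM modulus_real mzeta mulr1 gtr0_norm.
have z1 : z != 1.
  by apply/eqP => ze; move: t1; rewrite -zm ze modulus1 ltxx.
have one_zeta : 0 < modulus (1 - zeta) by rewrite modulus_gt0 subr_eq0 eq_sym.
have dist1 : modulus (1 - zeta) / 2 <= modulus (1 - z).
  have z_zeta : modulus (z - zeta) = 1 - t.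
    by rewrite modulus_radial_sub // distrC ger0_norm; lra.
  have := modulus_triangle z 1 zeta; rewrite z_zeta.
  have := modulus_sub_le 1 z; rewrite modulus1 zm; lra.
set X := (X in X <= _).
(* The bound is proved on the partial sums and passes to the limit. *)
suff : X - (B0 + B1) <= modulus (f z) by lra.
have zlt : modulus (z - 0) < 1 by rewrite subr0 zm.
apply: (modulus_lim_ge (N := 2 ^ (J + L)) (power_series_sum_cvg aA zlt)) => K LK.
have N1L : (N1 <= 2 ^ (J + L))%N by rewrite leq_exp2l // leq_addr.
have N1K := leq_trans N1L LK.
pose E := \sum_(N1 <= n < K) (2%N.-nat n)%:R * t ^+ n.
have E_real : \sum_(N1 <= n < K) (2%N.-nat n)%:R * z ^+ n = E%:RC.
  rewrite rmorph_sum /= !big_nat; apply: eq_bigr => n /andP[N1n _].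
  case: (boolP (2%N.-nat n)) => [n2|_]; last by rewrite !mul0r.
  by rewrite !mul1r /z exprMn (root _ N1n n2) mulr1 rmorphXn.
have E_ge : t ^+ (2 ^ (J + L)) * L%:R <= E.
  have F0 n : 0 <= (2%N.-nat n)%:R * t ^+ n by rewrite mulr_ge0 // exprn_ge0 // ltW.
  rewrite /E (big_cat_nat N1L LK) /=.
  apply: le_trans (_ : \sum_(N1 <= n < 2 ^ (J + L)) (2%N.-nat n)%:R * t ^+ n <= _); last first.
    by rewrite lerDl sumr_ge0.
  apply: le_trans (ler_wpM2l _ (count_pow2 J L)) _; first by rewrite exprn_ge0 // ltW.
  rewrite mulr_sumr !big_nat; apply: ler_sum => n /andP[_ nL].
  rewrite mulrC ler_wpM2l //.
  by apply: ler_wiXn2l (ltnW nL); exact: ltW.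
have -> : power_series a 0 z K = \sum_(0 <= n < N1) a n * z ^+ n
    + (alpha * \sum_(N1 <= n < K) z ^+ n + gamma * E%:RC).
  rewrite power_seriesE subr0 (big_cat_nat (leq0n _) N1K) /= -E_real; congr (_ + _).
  rewrite !mulr_sumr -big_split /= !big_nat; apply: eq_bigr => n /andP[N1n _].
  by rewrite aE ?(leq_trans N01) // mulrDl mulrA.
set P := \sum_(0 <= n < N1) _; set Q := \sum_(N1 <= n < K) _.
have P_le : modulus P <= B0.
  apply: le_trans (modulus_sum _ _ _) _; apply: ler_sum => n _.
  by rewrite modulusM modulusX zm ler_piMr ?modulus_ge0 // exprn_ile1 // ltW.
have Q_le : modulus (alpha * Q) <= B1.
  rewrite modulusM ler_wpM2l ?modulus_ge0 //.
  apply: le_trans (sum_unit_geometric_le _ _ _ z1) _; first by rewrite zm ltW.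
  rewrite ler_pdivrMr; last lra.
  rewrite mulrAC ler_pdivlMr //; lra.
have X_le : X <= modulus (gamma * E%:RC).
  rewrite modulusM modulus_real ler_wpM2l ?modulus_ge0 //.
  exact: le_trans E_ge (ler_norm _).
have := modulus_sub_le (gamma * E%:RC) (- (P + alpha * Q)).
have := modulusD P (alpha * Q).
rewrite opprK modulusN (addrC (gamma * _)) -addrA; lra.
Qed.

(** A continuation would be bounded near some dyadic root zeta <> 1, against
    the radial growth. *)
Lemma lacunary_not_continues : gamma != 0 -> ~ continues_across_circle f.
Proof.
move=> gamma0 [z0 [z01 [_ [/pos_complex_real[d d0 ->] [g [g_an gf]]]]]].
have {}z01 : modulus z0 = 1 by rewrite /modulus z01.
have [n near] : exists n, 2 * (3 / 4) ^+ n < d.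
  have q1 : `|3 / 4 : R| < 1 by rewrite ger0_norm; lra.
  have /cvgrPdist_lt/(_ _ d0)[n _ /(_ n (leqnn n))] := cvg_geometric 2 q1.
  rewrite sub0r normrN => /(le_lt_trans (ler_norm _)); by exists n.
have [zeta [zeta1 zetaX /le_lt_trans/(_ near) zeta_near]] := dyadic_root_near n z01.
have mzeta : modulus zeta = 1 by apply: unit_of_expr zetaX; rewrite expn_gt0.
have [J [B growth]] := lacunary_radial_growth zeta1 zetaX.
have [|s s0 [B' gB]] := @analytic_locally_bounded g zeta.
  by apply: g_an; apply/ball_modulus; rewrite modulus_distC.
have mg : 0 < modulus gamma by rewrite modulus_gt0.
pose L := (Num.truncn (2 * (B' + B) / modulus gamma)).+1.
have LP : 2 * (B' + B) < modulus gamma * L%:R.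
  by rewrite (mulrC (modulus gamma)) -ltr_pdivrMr // truncnS_gt.
pose K := (2 ^ (J + L))%N.
have K0 : 0 < K%:R :> R by rewrite ltr0n expn_gt0.
pose d' := d - modulus (z0 - zeta).
have d'0 : 0 < d' by rewrite /d'; lra.
(* The point (1 - h) zeta is close enough to zeta for the bound on g to
   apply, and (1 - h)^K >= 1/2 by Bernoulli's inequality since K h <= 1/2. *)
pose h := Num.min (Num.min s (d' / 2)) (Num.min 2^-1 (2^-1 / K%:R)).
have h0 : 0 < h by rewrite !lt_min s0 /= !divr_gt0 // andbT; apply/andP; split; lra.
have hs : h <= s by rewrite !ge_min lexx.
have hd' : h <= d' / 2 by rewrite !ge_min lexx orbT.
have h12 : h <= 2^-1 by rewrite !ge_min lexx !orbT.
have hK : K%:R * h <= 2^-1.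
  by rewrite mulrC -ler_pdivlMr // !ge_min lexx !orbT.
pose t := 1 - h; have t0 : 0 < t by rewrite /t; lra.
have t1 : t < 1 by rewrite /t; lra.
have z_zeta : modulus (t%:RC * zeta - zeta) = h.
  by rewrite modulus_radial_sub // distrC /t ger0_norm; lra.
have fB : modulus (f (t%:RC * zeta)) <= B'.
  rewrite -gf; first by apply: gB; rewrite z_zeta.
  split; [apply/unit_diskP|apply/ball_modulus].
    by rewrite modulusM modulus_real mzeta mulr1 gtr0_norm.
  apply: le_lt_trans (modulus_triangle zeta _ _) _; rewrite z_zeta modulus_distC.
  by move: hd' d'0; rewrite /d'; lra.
have tK : 2^-1 <= t ^+ K.
  have h1 : h <= 1 by lra.
  by apply: le_trans (bernoulli_sub K (ltW h0) h1); lra.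
have := growth L t t0 t1; rewrite -/K => /le_trans/(_ (lerD fB (lexx B))).
have L0 : 0 <= modulus gamma * L%:R by rewrite mulr_ge0 ?modulus_ge0 // ler0n.
rewrite mulrCA; nra.
Qed.

End PowersOfTwo.
End Lacunary.

(** * Sequences in a compact set *)

Section Density.
Context {R : realType}.
Local Notation C := (Cplx R).

Lemma compact_modulus_bounded (Omega : set C) : compact Omega ->
  exists A : R, forall z, Omega z -> modulus z <= A.
Proof.
move=> cO.
have : compact ((modulus : C -> R) @` Omega).
  apply: continuous_compact => //; apply: continuous_subspaceT => z.
  by apply: (cvg_modulus (f := id) (FF := nbhs_filter z)); exact: cvg_id.
move=> /compact_bounded[A [_ /(_ (A + 1))]]; rewrite ltrDl ltr01 => /(_ isT) AO.
by exists (A + 1) => z Oz; apply: le_trans (ler_norm _) (AO _ _); exists z.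
Qed.

Lemma coordinate_continuous (T : topologicalType) n :
  continuous (fun a : {ptws nat -> T} => a n).
Proof. exact: (@proj_continuous nat (fun=> T) n). Qed.

(** A neighbourhood of b constrains finitely many coordinates only, so agreement
    with b on longer and longer initial segments is enough. *)
Lemma ptws_eventually_eq_cvg (T : topologicalType)
    (a : nat -> {ptws nat -> T}) (b : {ptws nat -> T}) :
  (forall N n, (n < N)%N -> a N n = b n) -> a @ \oo --> b.
Proof.
move=> ab; apply/cvg_sup => n; apply/cvg_image.
  by apply/seteqP; split => // y _; exists (fun=> y).
move=> U /nbhs_singleton Ubn; exists [set f : nat -> T | U (f n)].
  by exists n.+1 => // N /= nN; rewrite ab.
by apply/seteqP; split=> [_ [f Uf <-]|y Uy] //; exists (fun=> y).
Qed.

End Density.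

Theorem theorem1p9 (R : realType) (Omega : set (Cplx R))
    (compact_Omega : compact Omega)
    (Omega_gt1 : exists a b, Omega a /\ Omega b /\ a <> b) :
  let S : set {ptws nat -> set_type Omega} :=
    [set a | has_natural_boundary
               (power_series_sum (fun n => set_val (a n)))] in
  dense S /\ Gdelta S.
Proof.
move=> S.
have [A AP] := compact_modulus_bounded compact_Omega.
have aA (a : {ptws nat -> set_type Omega}) n : modulus (set_val (a n)) <= A.
  by apply: AP; exact: set_valP.
split; last first.
  apply: (natural_boundary_Gdelta (a := fun (a : {ptws nat -> set_type Omega}) n => set_val (a n))) => //.
  move=> n t; apply: (@continuous_comp _ _ _ (fun a : {ptws nat -> set_type Omega} => a n)).
    exact: coordinate_continuous.
  exact: initial_continuous.
have [alpha [beta [Oalpha [Obeta ab]]]] := Omega_gt1.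
move=> U [b Ub] Uopen.
pose a N : {ptws nat -> set_type Omega} := fun n => if (n < N)%N then b n
  else if 2%N.-nat n then SigSub (mem_set Obeta) else SigSub (mem_set Oalpha).
have a_b : a @ \oo --> b.
  by apply: ptws_eventually_eq_cvg => N n nN; rewrite /a nN.
have [N _ /(_ N (leqnn N)) UaN] := a_b _ (open_nbhs_nbhs (conj Uopen Ub)).
exists (a N); split => //.
rewrite /S /=; apply/(has_natural_boundaryP (aA (a N))).
apply: (@lacunary_not_continues _ _ A N alpha (beta - alpha)) => //.
  move=> n Nn; rewrite /a ltnNge Nn /=; case: ifP => _ /=.
    by rewrite mulr1 addrC subrK.
  by rewrite mulr0 addr0.
by rewrite subr_eq0; apply/eqP => /esym.
Qed.
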